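(* Let $G$ be a stepwise transmission irregular (STI) graph of order $n\ge 4$. Then $$2n \le \mathrm{ecc}(G) \le \frac{n(n-1)}{2}.$$ Moreover, the left equality holds if and only if $G\cong K_{\frac{n-1}{2},\frac{n+1}{2}}$, and the right equality holds if and only if $G\cong G_n$.
   Context: All graphs are finite, simple and connected. The distance $d_G(u,v)$ is the number of edges on a shortest $u,v$-path. The transmission of a vertex $v$ is $\mathrm{Tr}_G(v)=\sum_{u\in V(G)} d_G(u,v)$. A connected graph $G$ is stepwise transmission irregular (STI) if $|\mathrm{Tr}_G(u)-\mathrm{Tr}_G(v)|=1$ for every edge $uv\in E(G)$. (It is known that every STI graph is bipartite and of odd order, so here in fact $n\ge 5$.) The eccentricity of a vertex $v$ is $\varepsilon_G(v)=\max_{u\in V(G)} d_G(u,v)$, and the eccentricity of the graph $G$ is the sum $\mathrm{ecc}(G)=\sum_{v\in V(G)}\varepsilon_G(v)$. $K_{p,q}$ denotes the complete bipartite graph with parts of sizes $p$ and $q$. For $n\ge 5$, the graph $G_n$ (hatted cycle) has vertex set $\{v_1,\ldots,v_n\}$, where $v_1,\ldots,v_{n-1}$ (in this cyclic order) induce a cycle of length $n-1$, and $v_n$ is adjacent exactly to $v_1$ and $v_3$. *)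

(* Defs.v *)
From mathcomp Require Import all_boot all_order all_algebra.

Set Implicit Arguments.
Unset Strict Implicit.
Unset Printing Implicit Defensive.

Definition simple_graph (T : Type) (e : rel T) : Prop :=
  symmetric e /\ irreflexive e.

Definition connected_graph (T : finType) (e : rel T) : Prop :=
  forall x y : T, connect e x y.

(* [path e x p] visits the vertices [x :: p], hence has [size p] edges.  If [y]
   is reachable from [x], then a shortest path has fewer than [#|T|] edges, so
   [find] returns the least length of an [x, y]-path; otherwise the value is
   [#|T|]. *)
Definition dist (T : finType) (e : rel T) (x y : T) : nat :=
  find (fun k => [exists p : k.-tuple T, path e x p && (last x p == y)])
       (iota 0 #|T|).

Definition transmission (T : finType) (e : rel T) (v : T) : nat :=
  \sum_(u : T) dist e u v.

Definition STI (T : finType) (e : rel T) : Prop :=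
  connected_graph e /\
  forall u v : T, e u v -> `|transmission e u - transmission e v|%N = 1.

Definition eccentricity (T : finType) (e : rel T) (v : T) : nat :=
  \max_(u : T) dist e u v.

Definition ecc (T : finType) (e : rel T) : nat :=
  \sum_(v : T) eccentricity e v.

Definition isomorphic (T U : Type) (e : rel T) (f : rel U) : Prop :=
  exists2 h : T -> U, bijective h & forall x y : T, f (h x) (h y) = e x y.

Definition complete_bipartite (p q : nat) : rel ('I_p + 'I_q) :=
  fun x y => match x, y with
             | inl _, inr _ | inr _, inl _ => true
             | _, _ => false
             end.

Arguments complete_bipartite : clear implicits.

(* The vertex v_k (1 <= k <= n) is the ordinal of value k - 1: the cycle is
   0, 1, ..., n - 2 and the hat n - 1 is joined to 0 and 2. *)
Definition hatted_arc (n : nat) (i j : 'I_n) : bool :=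
  [&& i < n - 1, j < n - 1 & j == i.+1 %% (n - 1) :> nat]
  || [&& i == n - 1 :> nat & (j == 0 :> nat) || (j == 2 :> nat)].

Definition hatted_cycle (n : nat) : rel 'I_n :=
  fun i j => hatted_arc i j || hatted_arc j i.
Arguments hatted_cycle : clear implicits.

(* Main.v *)
(* Along an edge [xy] the transmissions differ by the difference of the numbers of
   vertices closer to [x] and closer to [y].  Hence an STI graph is bipartite of
   odd order [2m + 1], and each end of an edge is the closer one for at least [m]
   vertices; for order at least 4 this rules out cut vertices.  So the distance
   levels of a vertex, except the first and the last, have at least two elements,
   which bounds every eccentricity by [m]; the lower bound holds as no vertex of
   such a graph is adjacent to all others.
     If all eccentricities are 2, vertices of distinct colours are at odd distance
   at most 2, so the graph is complete bipartite, and the closeness bound balances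
   the colour classes.  If all eccentricities are [m], exactly one level of each
   vertex exceeds the minimal sizes 1, 2, ..., 2, 1, by one.  Some vertex [v] has
   degree 3, since a 2-regular bipartite graph has even order; two neighbours
   [a], [b] of [v] then have the same neighbourhood [{v, p}].  For any other
   vertex [x], the extra vertex lies in the level of [a] and [b], so [x] has degree
   2.  Therefore deleting [b] leaves a 2-regular connected graph, a cycle through
   [v], [a], [p]. *)

Require Import Defs.
From mathcomp Require Import all_boot all_order all_algebra.
From mathcomp Require Import zify.

Set Implicit Arguments.
Unset Strict Implicit.
Unset Printing Implicit Defensive.

(** * Recognising a complete bipartite graph by its two classes *)

Lemma complete_bipartite_iso (T : finType) (e : rel T) (P : {set T}) p q :
    #|P| = p -> #|~: P| = q ->
    (forall x y, e x y = ((x \in P) != (y \in P))) ->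
  isomorphic e (complete_bipartite p q).
Proof.
move=> <- <- {p q} eE.
(* The bijection is built backwards, from the model to [T], so that injectivity and a count of
   vertices provide the inverse [h]. *)
pose g (u : 'I_#|P| + 'I_#|~: P|) : T :=
  match u with inl i => enum_val i | inr j => enum_val j end.
have gP u : (g u \in P) = if u is inl _ then true else false.
  case: u => u /=; first by have := enum_valP u.
  by have := enum_valP u; rewrite inE => /negPf.
have g_inj : injective g.
  move=> u w guw; have := gP u; rewrite guw gP.
  case: u w guw => u [] w //= guw _; congr (_ _); exact: (enum_val_inj guw).
have [|h hK gK] := inj_card_bij g_inj.
  by rewrite card_sum !card_ord cardsC.
exists h => [|x y]; first by exists g.
by rewrite eE -{2}(gK x) -{2}(gK y) !gP; case: (h x) (h y) => ? [].
Qed.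

(** * Recognising a hatted cycle *)

Section HattedIso.

(** In the model [v], [a], [p] become the cycle positions 0, 1, 2 and [b], which has the same
    neighbours as [a], becomes the hat. *)
Variables (T : finType) (e : rel T) (v a p b : T).
Hypotheses (e_sym : symmetric e) (e_irr : irreflexive e).
Hypotheses (neq_vp : v != p) (neq_ab : a != b).
Hypotheses (adj_a : forall y, e a y = (y == v) || (y == p)).
Hypotheses (adj_b : forall y, e b y = (y == v) || (y == p)).
Hypothesis deg2 : forall x, x != b -> #|[set y | e x y & y != b]| = 2.
Hypothesis b_not_cut : forall A B : {set T},
    A != set0 -> B != set0 -> [disjoint A & B] -> A :|: B = [set~ b] ->
  exists x y, [/\ x \in A, y \in B & e x y].

Let neq_bv : b != v.
Proof. by apply/eqP => bv; have := adj_b v; rewrite -bv e_irr eqxx. Qed.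

Let neq_bp : b != p.
Proof. by apply/eqP => bp; have := adj_b p; rewrite -bp e_irr eqxx orbT. Qed.

Let neq_av : a != v.
Proof. by apply/eqP => av; have := adj_a v; rewrite -av e_irr eqxx. Qed.

Let neq_ap : a != p.
Proof. by apply/eqP => ap; have := adj_a p; rewrite -ap e_irr eqxx orbT. Qed.

(** Otherwise [x] would have three neighbours other than [b]. *)
Lemma adj_deg2 x y z t : x != b -> y != z -> y != b -> z != b -> t != b ->
  e x y -> e x z -> e x t -> (t == y) || (t == z).
Proof.
move=> xb yz yb zb tb exy exz ext; apply: contraTT isT.
rewrite negb_or => /andP[ty tz].
have : #|[set y; z; t]| <= #|[set y | e x y & y != b]|.
  apply/subset_leq_card/subsetP => u; rewrite !inE -orbA.
  by case/or3P => /eqP->; apply/andP.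
by rewrite deg2 // -setUA cardsU1 cards2 !inE negb_or yz ![_ == t]eq_sym ty tz.
Qed.

(* A path of the 2-regular graph [T \ b] that cannot be extended closes up into
   a cycle, which then covers all of [T \ b]. *)
Section MaximalPath.

Variables (N : nat) (x : nat -> T).
Hypothesis N_gt2 : 2 < N.
Hypothesis xb : forall i, i < N -> x i != b.
Hypothesis x_inj : forall i j, i < N -> j < N -> (x i == x j) = (i == j).
Hypothesis ex : forall i, i.+1 < N -> e (x i) (x i.+1).
Hypothesis x_max : forall z, e (x N.-1) z -> z != b -> exists2 j, j < N & x j = z.

(** The last vertex has a second neighbour besides its predecessor, and by maximality it lies on the
    path. An inner vertex of the path already has its two path neighbours, so only [x 0] remains. *)
Lemma maximal_path_closed : e (x N.-1) (x 0).
Proof.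
have N1 : N.-1 < N by lia.
have : 0 < #|[set y | e (x N.-1) y & y != b] :\ x N.-2|.
  have := deg2 (xb N1); rewrite (cardsD1 (x N.-2)).
  by case: (_ \in _); lia.
case/card_gt0P => z; rewrite !inE => /and3P[zN2 ez zb].
have [j jN zE] := x_max ez zb.
have jN1 : j != N.-1 by apply: contraTneq ez => jE; rewrite -zE jE e_irr.
have jN2 : j != N.-2 by apply: contraNneq zN2 => jE; rewrite -zE jE.
case: j => [|j] in zE jN jN1 jN2 *; first by rewrite zE.
rewrite -{}zE e_sym in ez zb *.
have jN' : j < N by apply: ltnW.
have jN3 : j.+2 < N by move: jN jN1 jN2; clear; lia.
have := adj_deg2 (xb jN) _ (xb jN') (xb jN3) (xb N1) _ (ex jN3) ez.
by rewrite e_sym ex // !x_inj //; move: N_gt2 jN jN1 jN2; clear; lia.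
Qed.

Let modS i : i < N -> i.+1 %% N = if i.+1 == N then 0 else i.+1.
Proof.
move=> iN; case: eqP => [->|?]; first exact: modnn.
by rewrite modn_small //; lia.
Qed.

Let nextN i : i.+1 %% N < N.
Proof. by apply: ltn_pmod; lia. Qed.

Let ex_next i : i < N -> e (x i) (x (i.+1 %% N)).
Proof.
move=> iN; rewrite modS //; case: eqP => [iE | ?]; last by apply: ex; lia.
have -> : i = N.-1 by lia.
exact: maximal_path_closed.
Qed.

(** As [2 < N], the cyclic predecessor and successor of [x i] are distinct, and so they exhaust its
    two neighbours other than [b]. *)
Lemma maximal_path_adj i z : i < N -> z != b -> e (x i) z ->
  exists2 j, j < N & z = x j /\ ((j == i.+1 %% N) || (i == j.+1 %% N)).
Proof.
move=> iN zb ez.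
have [j jN jE] : exists2 j, j < N & j.+1 %% N = i.
  case: i iN {ez} => [|i] iN.
    by exists N.-1; rewrite ?modS ?prednK ?eqxx //; exact: ltn_trans N_gt2.
  by exists i; rewrite ?modS 1?ltnW // ltn_eqF.
have ej : e (x i) (x j) by rewrite e_sym -jE ex_next.
have xji : x j != x (i.+1 %% N).
  rewrite x_inj ?nextN //; move: jE; rewrite !modS //.
  move: iN jN N_gt2; clear; case: (j.+1 =P N) => ? ? ? ? <-; case: ifP; lia.
have := adj_deg2 (xb iN) xji (xb jN) (xb (nextN i)) zb ej (ex_next iN) ez.
case/orP => /eqP ->; first by exists j; rewrite ?jE ?eqxx ?orbT.
by exists (i.+1 %% N); rewrite ?eqxx ?nextN.
Qed.

Lemma maximal_path_edge i j : i < N -> j < N ->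
  e (x i) (x j) = (j == i.+1 %% N) || (i == j.+1 %% N).
Proof.
move=> iN jN; apply/idP/orP => [eij | [/eqP->|/eqP->]].
- have [k kN [/eqP]] := maximal_path_adj iN (xb jN) eij.
  by rewrite x_inj // => /eqP-> /orP.
- exact: ex_next.
- by rewrite e_sym ex_next.
Qed.

(** No edge leaves the set [A] of path vertices except towards [b]; a missed vertex would make [b] a
    cut vertex. *)
Lemma maximal_path_cover z : z != b -> exists2 i, i < N & x i = z.
Proof.
move=> zb; pose A := [set u | [exists i : 'I_N, x i == u]].
suff : z \in A by rewrite inE => /existsP[i /eqP xi]; exists i.
apply: contraT => zA.
have xA i : i < N -> x i \in A.
  by move=> iN; rewrite inE; apply/existsP; exists (Ordinal iN).
have bA : b \notin A.
  rewrite inE; apply/existsP => -[i /eqP xi].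
  by have := xb (ltn_ord i); rewrite xi eqxx.
have [||||u [w [uA]]] := @b_not_cut A (~: A :\ b).
- by apply/set0Pn; exists (x 0); apply: xA; lia.
- by apply/set0Pn; exists z; rewrite in_setD1 zb inE.
- rewrite disjoint_subset; apply/subsetP => u uA.
  by rewrite 2!inE [u \in ~: _]inE uA andbF.
- apply/setP=> u; rewrite in_setU in_setD1 in_setC in_setC1 orbC.
  case: eqP => [->|_]; first by rewrite (negPf bA).
  by rewrite orNb.
rewrite in_setD1 in_setC => /andP[wb wA] euw; move: uA.
rewrite inE => /existsP[i /eqP xi]; rewrite -xi in euw.
have [j jN [wE _]] := maximal_path_adj (ltn_ord i) wb euw.
by rewrite wE xA in wA.
Qed.

End MaximalPath.

(** A longest path avoiding [b] is taken among those that start with [v], [a], [p]; this start fixes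
    the vertices at positions 0 and 2. Paths without repetition have bounded length, so a longest
    one exists, and it cannot be extended at its end. *)
Lemma hamiltonian_cycle : exists s, [/\ size s = #|T|.-1, uniq s,
  forall z, (z \in s) = (z != b),
  [/\ 2 < size s, nth v s 0 = v & nth v s 2 = p] &
  forall i j, i < size s -> j < size s -> e (nth v s i) (nth v s j)
    = (j == i.+1 %% size s) || (i == j.+1 %% size s)].
Proof.
pose good t := [&& path e v [:: a, p & t], uniq [:: v, a, p & t]
                 & b \notin [:: v, a, p & t]].
pose P k := [exists t : k.-tuple T, good t].
have exP : exists k, P k.
  exists 0; apply/existsP; exists [tuple].
  rewrite /good /= (e_sym v) !adj_a !eqxx orbT !inE.
  rewrite !negb_or neq_vp neq_bv neq_bp neq_ap.
  by rewrite (eq_sym v a) (eq_sym b a) neq_av neq_ab.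
have ubP k : P k -> k <= #|T|.
  case/existsP=> t /and3P[_ /=/and4P[_ _ _ Ut] _].
  by rewrite -(size_tuple t) -(card_uniqP Ut) max_card.
case: (ex_maxnP exP ubP) => k /existsP[t /and3P[es Us bs]] max_k.
have {max_k} max_t z : e (last p t) z -> z != b -> z \in [:: v, a, p & t].
  move=> ez zb; apply: contraT => zs.
  suff /max_k : P k.+1 by rewrite ltnn.
  apply/existsP; exists [tuple of rcons t z]; rewrite /good [tval _]/= -!rcons_cons.
  rewrite rcons_path es rcons_uniq zs Us /= ez -!rcons_cons.
  by rewrite mem_rcons inE negb_or eq_sym zb.
set s := [:: v, a, p & t] in Us bs max_t.
have sb i : i < size s -> nth v s i != b.
  by move=> iN; apply: contraNneq bs => <-; apply: mem_nth.
have s_inj i j : i < size s -> j < size s -> (nth v s i == nth v s j) = (i == j).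
  by move=> iN jN; apply: nth_uniq.
have es' i : i.+1 < size s -> e (nth v s i) (nth v s i.+1).
  by move=> iN; have /pathP-/(_ v i) := es; apply.
have s_max z : e (nth v s (size s).-1) z -> z != b ->
    exists2 j, j < size s & nth v s j = z.
  by rewrite nth_last => ez zb; apply/nthP/max_t.
have mem_s z : (z \in s) = (z != b).
  apply/idP/idP => [|zb]; first by apply: contraTneq => ->.
  by apply/(nthP v); apply: maximal_path_cover => //.
exists s; split=> //; last first.
  by move=> i j iN jN; apply: maximal_path_edge.
by rewrite -(card_uniqP Us) (eq_card mem_s) (cardC1 b).
Qed.

Lemma hatted_cycle_iso : isomorphic e (hatted_cycle #|T|).
Proof.
have [s [sz Us mem_s [s_gt2 s0 s2] edge_s]] := hamiltonian_cycle.
have T_gt0 : 0 < #|T| by rewrite (cardD1 v).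
have idxT z : index z s < #|T|.
  by rewrite -(prednK T_gt0) ltnS -sz index_size.
have idx_b : index b s = #|T| - 1 by rewrite memNindex ?mem_s ?eqxx // sz subn1.
have idx_nb z : z != b -> index z s < #|T| - 1.
  by rewrite -mem_s -index_mem sz subn1.
(* As [b] does not occur in [s], its index is [size s], which is exactly the label of the hat. *)
pose h z := Ordinal (idxT z).
have h_inj : injective h.
  move=> y z [yz]; have [yb|yb] := eqVneq y b; have [zb|zb] := eqVneq z b.
  - by rewrite yb zb.
  - by have := idx_nb z zb; rewrite -yz yb idx_b ltnn.
  - by have := idx_nb y yb; rewrite yz zb idx_b ltnn.
  - by apply: (@index_inj _ v s); rewrite ?mem_s.
exists h; first by apply: inj_card_bij h_inj _; rewrite card_ord.
have sN : size s = #|T| - 1 by rewrite sz subn1.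
rewrite sN in s_gt2 edge_s.
have idxE i z : i < #|T| - 1 -> (index z s == i) = (z == nth v s i).
  rewrite -sN => iN; apply/eqP/eqP => [zi|->]; last exact: index_uniq.
  by rewrite -zi nth_index // -index_mem zi.
have arc_b z : hatted_cycle #|T| (h b) (h z) = e b z.
  rewrite /hatted_cycle /hatted_arc /= idx_b !ltnn eqxx /= adj_b andbF.
  have N_gt0 : 0 < #|T| - 1 by apply: ltn_trans s_gt2.
  rewrite (gtn_eqF N_gt0) (gtn_eqF s_gt2) andbF !orbF.
  by rewrite (idxE 0) // (idxE 2) // s0 s2.
move=> y z; have [-> // | yb] := eqVneq y b.
have [-> | zb] := eqVneq z b.
  by rewrite e_sym -arc_b /hatted_cycle orbC.
have [yN zN] := (idx_nb y yb, idx_nb z zb).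
rewrite -{2}(nth_index v (_ : y \in s)) ?mem_s //.
rewrite -{2}(nth_index v (_ : z \in s)) ?mem_s //.
rewrite edge_s // /hatted_cycle /hatted_arc /= yN zN /=.
by rewrite (ltn_eqF yN) (ltn_eqF zN) !orbF.
Qed.

End HattedIso.

(** * Shortest paths and distances in a connected graph *)

Section Distance.

Variables (T : finType) (e : rel T).
Hypotheses (e_sym : symmetric e) (e_conn : connected_graph e).

Lemma dist_le_path x p : path e x p -> dist e x (last x p) <= size p.
Proof.
move=> ep; rewrite /dist; set a := fun k => _.
case: (ltnP (size p) #|T|) => [lt_p_T | le_T_p].
  rewrite leqNgt; apply/negP=> /(before_find 0); rewrite nth_iota // add0n.
  by move/existsP; apply; exists (in_tuple p); rewrite /= ep eqxx.
(* A path too long for the search range needs no search: [find] never exceeds the length of its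
   list. *)
by apply: leq_trans (find_size _ _) _; rewrite size_iota.
Qed.

Lemma geodesic x y :
  exists p, [/\ path e x p, last x p = y & size p = dist e x y].
Proof.
set a := fun k => [exists p : k.-tuple T, path e x p && (last x p == y)].
have has_a : has a (iota 0 #|T|).
  have /connectP[p0 ep0 y_last] := e_conn x y.
  (* Removing repetitions brings the length below [#|T|], into the search range. *)
  case/shortenP: ep0 y_last => p ep Up _ lastE.
  apply/hasP; exists (size p); last first.
    by apply/existsP; exists (in_tuple p); rewrite /= ep lastE eqxx.
  rewrite mem_iota /= add0n; apply: (@leq_trans (size (x :: p))) => //.
  by rewrite -(card_uniqP Up) max_card.
have := nth_find 0 has_a; rewrite -/(dist e x y) nth_iota ?add0n; last first.
  by rewrite -[X in _ < X](size_iota 0) -has_find.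
by case/existsP=> p /andP[ep /eqP lastE]; exists p; rewrite size_tuple.
Qed.

Lemma dist_self x : dist e x x = 0.
Proof. by apply/eqP; rewrite -leqn0 (@dist_le_path x [::]). Qed.

Lemma dist_eq0 x y : (dist e x y == 0) = (x == y).
Proof.
apply/eqP/eqP=> [d0 | ->]; last exact: dist_self.
have [p [_ lastp sz]] := geodesic x y; rewrite d0 in sz.
by rewrite -lastp (size0nil sz).
Qed.

Lemma dist_triangle y x z : dist e x z <= dist e x y + dist e y z.
Proof.
have [p [ep <- <-]] := geodesic x y; have [q [eq <- <-]] := geodesic (last x p) z.
by rewrite -size_cat -last_cat dist_le_path // cat_path ep.
Qed.

Lemma dist_edge x y : e x y -> dist e x y <= 1.
Proof. by move=> exy; apply: (@dist_le_path x [:: y]); rewrite /= exy. Qed.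

Lemma dist_adj x y z : e y z -> dist e x z <= (dist e x y).+1.
Proof.
by move=> /dist_edge dyz; rewrite -addn1 (leq_trans (dist_triangle y x z)) ?leq_add2l.
Qed.

Lemma distC x y : dist e x y = dist e y x.
Proof.
wlog suff: x y / dist e x y <= dist e y x.
  by move=> le_d; apply/eqP; rewrite eqn_leq !le_d.
have [p [ep <- <-]] := geodesic y x.
rewrite -(size_belast y p) -size_rev; set q := rev _.
have lastq : last (last y p) q = y.
  by rewrite /q; case: (p) => //= z p'; rewrite rev_cons last_rcons.
have := @dist_le_path (last y p) q; rewrite lastq; apply.
by rewrite /q rev_path; apply: sub_path ep => u v; rewrite e_sym.
Qed.

Lemma dist_pred x y k : dist e x y = k.+1 -> exists2 z, dist e x z = k & e z y.
Proof.
have [p [ep lastp sz]] := geodesic x y.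
case/lastP: p ep lastp sz => [_ _ <- // | p z].
rewrite rcons_path last_rcons size_rcons => /andP[ep ez] zy sz [szp].
rewrite -zy; exists (last x p) => //; apply/eqP.
have := dist_le_path ep; have := dist_adj x ez.
rewrite zy szp; move: sz; lia.
Qed.

Lemma dist_eq1 x y : x != y -> (dist e x y == 1) = e x y.
Proof.
move=> neq_xy; apply/eqP/idP=> [d1 | /dist_edge].
  by have [z /eqP] := dist_pred d1; rewrite dist_eq0 => /eqP->.
by rewrite leq_eqVlt ltnS leqn0 dist_eq0 (negPf neq_xy) orbF => /eqP.
Qed.

Lemma dist_level x y k : k <= dist e x y -> exists z, dist e x z = k.
Proof.
move: {-1}(dist e x y) (erefl (dist e x y)) => d.
elim: d y => [|d IHd] y dxy; last first.
  rewrite leq_eqVlt => /predU1P[-> | ]; first by exists y.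
  by have [z dxz _] := dist_pred dxy; apply: (IHd z).
by rewrite leqn0 => /eqP->; exists x; rewrite dist_self.
Qed.

(** A tool for bounding distances from below by a function that grows by at most one along each
    edge. *)
Lemma lipschitz_le_dist (f : T -> nat) x y :
  (forall u v, e u v -> f v <= (f u).+1) -> f y <= f x + dist e x y.
Proof.
move=> f_lip; have [p [ep <- <-]] := geodesic x y.
elim: p x ep {y} => [|z p IHp] x /=; first by rewrite addn0.
by case/andP=> /f_lip fz /IHp; lia.
Qed.

Lemma le_eccentricity x y : dist e y x <= eccentricity e x.
Proof. exact: (leq_bigmax_cond (F := fun u => dist e u x)). Qed.

Lemma eccentricity_witness x : exists y, dist e x y = eccentricity e x.
Proof.
have T_gt0 : 0 < #|T| by apply/card_gt0P; exists x.
have [y ecc_y] := eq_bigmax (fun u => dist e u x) T_gt0.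
by exists y; rewrite distC /eccentricity ecc_y.
Qed.

(** * Parity and closeness in STI graphs *)

Hypotheses (e_sti : STI e) (T_ge4 : 4 <= #|T|).

(** Transmissions of adjacent vertices differ by one, so their parity is a proper 2-colouring. *)
Let colour x := odd (transmission e x).

Lemma colour_adj x y : e x y -> colour y = ~~ colour x.
Proof.
have [_ sti] := e_sti; move=> /sti /eqP; rewrite distn_eq1 /colour.
by case: ifP => _ /eqP => [<-|->] /=; rewrite ?negbK.
Qed.

Lemma e_irr x : e x x = false.
Proof. by apply/negP => /colour_adj; case: (colour x). Qed.

Lemma dist_parity x y : odd (dist e x y) = colour x (+) colour y.
Proof.
move: {-1}(dist e x y) (erefl (dist e x y)) => d.
elim: d y => [|d IHd] y dxy.
  by move/eqP: dxy; rewrite dist_eq0 => /eqP->; rewrite addbb.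
have [z dxz /colour_adj->] := dist_pred dxy.
by rewrite addbN -IHd.
Qed.

Lemma dist_adj_neq x y z : e y z -> dist e x y != dist e x z.
Proof.
move=> /colour_adj cz; apply/eqP=> /(congr1 odd).
by rewrite !dist_parity cz; case: (colour x); case: (colour y).
Qed.

Definition closer x y := [set u | dist e u x < dist e u y].

(** Every vertex is closer to one end of the edge, by exactly one. Summing over all vertices, the
    two closeness counts differ by as much as the transmissions, that is by one, while they add up
    to the order. *)
Lemma card_closer x y : e x y ->
  [/\ #|closer x y| + #|closer y x| = #|T|, odd #|T|
     & #|T|./2 <= #|closer x y|].
Proof.
move=> exy; have cardE u v : #|closer u v| = \sum_w (dist e w u < dist e w v).
  by rewrite -sum1_card big_mkcond; apply: eq_bigr => w _; rewrite inE; case: ifP.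
have [_ /(_ _ _ exy)/eqP] := e_sti; rewrite distn_eq1 => tr1.
have sumE : #|closer x y| + #|closer y x| = #|T|.
  rewrite !cardE -big_split -sum1_card; apply: eq_bigr => w _.
  by have := dist_adj_neq w exy; rewrite /=; lia.
have trE : transmission e x + #|closer x y| = transmission e y + #|closer y x|.
  rewrite /transmission !cardE -!big_split /=; apply: eq_bigr => w _.
  have := dist_adj w exy; have := dist_adj_neq w exy.
  by move: exy; rewrite e_sym => /(dist_adj w); lia.
by split=> //; move: sumE tr1 trE; case: ifP => _ + /eqP; lia.
Qed.

Lemma odd_order : odd #|T|.
Proof.
have /card_gt0P[x _] : 0 < #|T| by lia.
have [y yx] : exists y, y != x.
  apply/existsP; rewrite -negb_forall; apply: contraTN T_ge4 => /forallP eqx.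
  rewrite -ltnNge (@leq_ltn_trans 1) //; apply/card_le1P => u _ v.
  by rewrite !inE (eqP (eqx u)) (eqP (eqx v)) eqxx.
case dxy: (dist e x y) => [|k].
  by move/eqP: dxy; rewrite dist_eq0 eq_sym (negPf yx).
by have [z _ /card_closer[]] := dist_pred dxy.
Qed.

Let m := #|T|./2.

Lemma orderE : #|T| = m.*2.+1.
Proof. by rewrite -[LHS]odd_double_half odd_order. Qed.

Lemma m_gt1 : 1 < m.
Proof. by have := orderE; have := T_ge4; lia. Qed.

(** * Absence of cut vertices *)

Definition enclosed (S : {set T}) w :=
  forall x y, x \in S -> e x y -> y \notin S -> y = w.

(** A path from a vertex outside [S] can enter [S] only from [w], so such a vertex is closer to [w]
    than to any vertex of [S]. *)
Lemma enclosed_closer (S : {set T}) w z :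
  enclosed S w -> z \in S -> e z w -> closer z w \subset S.
Proof.
move=> Sw zS ezw; apply/subsetP => u; apply: contraLR => uS.
rewrite inE -leqNgt.
suff {z zS ezw} lt_d d z : dist e u z = d -> z \in S -> dist e u w < d.
  exact/ltnW/(lt_d _ z).
elim: d z => [|d IHd] z duz zS.
  by move/eqP: duz uS; rewrite dist_eq0 => /eqP ->; rewrite zS.
have [t dut etz] := dist_pred duz.
have [tS | /(Sw z)] := boolP (t \in S); first exact/ltnW/(IHd t).
by rewrite e_sym => /(_ zS etz) <-; rewrite dut.
Qed.

(** Otherwise [S] would be closed under adjacency, and connectedness would put [w] into it. *)
Lemma enclosed_gate (S : {set T}) w : enclosed S w -> w \notin S -> S != set0 ->
  exists2 z, z \in S & e z w.
Proof.
move=> Sw wS /set0Pn[x xS].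
case: (pickP [pred z in S | e z w]) => [z /andP[] | no_gate]; first by exists z.
have S_closed : closed e S.
  suff e_S y z : e y z -> y \in S -> z \in S.
    by move=> y z eyz; apply/idP/idP; apply: e_S; rewrite // e_sym.
  move=> eyz yS; apply: contraT => zS.
  by have /= := no_gate y; rewrite yS -(Sw y z) // eyz.
by case/negP: wS; rewrite -(closed_connect S_closed (e_conn x w)).
Qed.

Lemma card_enclosed (S : {set T}) w :
  enclosed S w -> w \notin S -> S != set0 -> m <= #|S|.
Proof.
move=> Sw wS S_neq0; have [z zS ezw] := enclosed_gate Sw wS S_neq0.
have [_ _ /leq_trans->//] := card_closer ezw.
exact/subset_leq_card/enclosed_closer.
Qed.

(** If no edge joins [A] to [B], both are enclosed by [w], so each has at least [m] of the [2m]
    remaining vertices, hence exactly [m]. For a neighbour [z] of [w] in [A] this forces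
    [closer z w = A]. *)
Lemma no_cut_vertex (A B : {set T}) w :
    A != set0 -> B != set0 -> [disjoint A & B] -> A :|: B = [set~ w] ->
  exists x y, [/\ x \in A, y \in B & e x y].
Proof.
move=> A0 B0 dAB AB.
case: (pickP [pred u : T * T | [&& u.1 \in A, u.2 \in B & e u.1 u.2]]).
  by move=> [x y] /and3P; exists x, y.
move=> no_edge; exfalso.
have cardAB : #|A| + #|B| = m.*2.
  have := leq_card_setU A B; rewrite dAB => -[_ /eqP <-].
  by rewrite AB cardsC1 orderE.
have wA : w \notin A by have := setC11 w; rewrite -AB inE => /norP[].
have wB : w \notin B by have := setC11 w; rewrite -AB inE => /norP[].
have out x : x \notin A -> x \notin B -> x = w.
  move=> xA xB; apply/eqP; rewrite -[_ == _]negbK -in_setC1 -AB inE.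
  by rewrite negb_or xA.
have encA : enclosed A w.
  move=> x y xA exy yA; apply: out => //.
  by apply/negP=> yB; have /= := no_edge (x, y); rewrite xA yB exy.
have encB : enclosed B w.
  move=> x y xB exy yB; apply: out => //; apply/negP=> yA.
  by have /= := no_edge (y, x); rewrite xB yA e_sym exy.
have mA := card_enclosed encA wA A0; have mB := card_enclosed encB wB B0.
have {mA mB cardAB} cardA : #|A| = m by lia.
have [z zA ezw] := enclosed_gate encA wA A0.
have cloA : closer z w = A.
  apply/eqP; rewrite eqEcard enclosed_closer //= cardA.
  by have [] := card_closer ezw.
(* A neighbour of [w] in [A] is closer to [z] than to [w], hence equals [z]. So [z] encloses the
   rest of [A], which is nonempty but has only [m - 1] vertices. *)
have encA' : enclosed (A :\ z) z.
  move=> x y /setD1P[xz xA] exy; rewrite in_setD1 negb_and negbK.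
  case/orP=> [/eqP // | yA]; case/eqP: xz; apply/eqP.
  have yw := encA x y xA exy yA; rewrite {}yw in exy.
  by have := xA; rewrite -cloA inE -dist_eq0; have := dist_edge exy; clear; lia.
have cardA' : #|A :\ z| = m.-1 by rewrite -cardA (cardsD1 z A) zA.
have := card_enclosed encA'; rewrite setD11 -card_gt0 cardA' => /(_ isT).
by have := m_gt1; lia.
Qed.

(** * Distance levels and the bounds on eccentricities *)

Definition level x i := [set y | dist e x y == i].

Lemma level_pred x i y : y \in level x i.+1 -> exists2 z, z \in level x i & e z y.
Proof.
by rewrite inE => /eqP/dist_pred[z dz ezy]; exists z; rewrite // inE dz.
Qed.

(** Bipartiteness excludes edges inside a level; the conjunct [0 < i] discards the truncated
    predecessor of 0. *)
Lemma level_adj x i y z : e y z -> y \in level x i ->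
  (z \in level x i.-1) && (0 < i) || (z \in level x i.+1).
Proof.
move=> eyz; rewrite !inE => /eqP dy.
have := dist_adj x eyz; have := dist_adj_neq x eyz.
by move: eyz; rewrite e_sym => /(dist_adj x); rewrite dy; lia.
Qed.

(** As [w] is not a cut vertex, an edge avoiding it joins the vertices at distance at most [i] to
    those farther away; it must run from level [i] to level [i.+1]. *)
Lemma level_down x i w y : 0 < i -> i < dist e x y -> w \in level x i ->
  exists z t, [/\ z != w, z \in level x i, t \in level x i.+1 & e z t].
Proof.
rewrite inE => i_gt0 lt_iy /eqP dw.
pose A := [set u | (dist e x u <= i) && (u != w)].
pose B := [set u | i < dist e x u].
have [] := @no_cut_vertex A B w.
- apply/set0Pn; exists x; rewrite inE dist_self /=.
  by apply: contraTneq i_gt0 => xw; rewrite -dw -xw dist_self.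
- by apply/set0Pn; exists y; rewrite inE.
- rewrite disjoint_subset; apply/subsetP => u; rewrite !inE => /andP[le_ui _].
  by rewrite -leqNgt.
- apply/setP=> u; rewrite !inE; case: eqP => [->|_]; first by rewrite dw ltnn andbF.
  by rewrite andbT; case: leqP.
move=> z [t [/setIdP[le_zi zw]]]; rewrite inE => lt_it ezt.
have le_tz := dist_adj x ezt; exists z, t; split => //; rewrite inE; lia.
Qed.

Lemma card_level_ge2 x i y : 0 < i -> i < dist e x y -> 1 < #|level x i|.
Proof.
move=> i_gt0 lt_iy; have [w dw] := dist_level (ltnW lt_iy).
have w_i : w \in level x i by rewrite inE dw.
have [z [_ [zw z_i _ _]]] := level_down i_gt0 lt_iy w_i.
by apply/card_gt1P; exists z, w.
Qed.

Lemma sum_levels x k : eccentricity e x <= k ->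
  \sum_(i < k.+1) #|level x i| = m.*2.+1.
Proof.
move=> ecc_k; rewrite -orderE -sum1_card.
have cardE i : #|level x i| = \sum_y (dist e x y == i).
  by rewrite -sum1_card big_mkcond; apply: eq_bigr => y _; rewrite inE; case: ifP.
rewrite (eq_bigr _ (fun (i : 'I_k.+1) _ => cardE i)) exchange_big; apply: eq_bigr => y _.
have lt_yk : dist e x y < k.+1 by rewrite ltnS distC (leq_trans (le_eccentricity _ _)).
rewrite (bigD1 (Ordinal lt_yk)) //= eqxx big1 // => i neq_i.
apply/eqP; rewrite eqb0; apply: contraNneq neq_i => yi.
exact/eqP/val_inj.
Qed.

(** The least possible size of level [i] of a vertex of eccentricity [k]: one at both ends, two in
    between. *)
Definition min_level k i := if (i == 0) || (i == k) then 1 else 2.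

Lemma sum_min_level k : 0 < k -> \sum_(i < k.+1) min_level k i = k.*2.
Proof.
case: k => // k _; rewrite big_ord_recl big_ord_recr /= /min_level /= eqxx.
rewrite (eq_bigr (fun=> 2)) => [|i _]; first by rewrite sum_nat_const card_ord; lia.
by rewrite /bump /= !add1n eqSS; case: eqP => // ik; have := ltn_ord i; lia.
Qed.

Lemma min_level_le x i : i <= eccentricity e x ->
  min_level (eccentricity e x) i <= #|level x i|.
Proof.
have [y dy] := eccentricity_witness x; rewrite /min_level -dy => le_iy.
case: ifP => [_ | /norP[i0 iy]]; last by apply: (@card_level_ge2 x i y); lia.
by have [z dz] := dist_level le_iy; apply/card_gt0P; exists z; rewrite inE dz.
Qed.

Lemma eccentricity_gt0 x : 0 < eccentricity e x.
Proof.
rewrite lt0n; apply/eqP => ecc0.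
have := sum_levels (eq_leq ecc0); rewrite big_ord_recl big_ord0 addn0 /= => cardL.
have : #|level x 0| <= #|[set x]|.
  by apply/subset_leq_card/subsetP => y; rewrite !inE dist_eq0 eq_sym.
by rewrite cards1 cardL; have := m_gt1; lia.
Qed.

(** The minimal level sizes add up to twice the eccentricity, the actual ones to [2m + 1]. *)
Lemma eccentricity_le x : eccentricity e x <= m.
Proof.
have := sum_levels (leqnn (eccentricity e x)).
have := sum_min_level (eccentricity_gt0 x).
suff : \sum_(i < (eccentricity e x).+1) min_level (eccentricity e x) i
    <= \sum_(i < (eccentricity e x).+1) #|level x i| by lia.
by apply: leq_sum => i _; apply: min_level_le; rewrite -ltnS.
Qed.

(** If all distances from [x] are at most 1, only [y] itself is closer to a neighbour [y] than to
    [x], while at least [m > 1] vertices must be. *)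
Lemma eccentricity_ge2 x : 1 < eccentricity e x.
Proof.
rewrite ltn_neqAle eccentricity_gt0 andbT eq_sym; apply/eqP=> ecc1.
have [y] := eccentricity_witness x; rewrite ecc1 => /eqP dxy.
have xy : x != y by rewrite -dist_eq0 (eqP dxy).
move: dxy; rewrite (dist_eq1 xy) e_sym => eyx.
have [_ _ m_le] := card_closer eyx.
have /subset_leq_card : closer y x \subset [set y].
  apply/subsetP => u; rewrite !inE => lt_d.
  rewrite -dist_eq0 -leqn0 -ltnS (leq_trans lt_d) // -ecc1.
  exact: le_eccentricity.
by rewrite cards1; have := m_gt1; rewrite /m; lia.
Qed.

Lemma ecc_ge : 2 * #|T| <= ecc e.
Proof.
by rewrite mulnC -sum_nat_const; apply: leq_sum => x _; apply: eccentricity_ge2.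
Qed.

Lemma ecc_le : ecc e <= m * #|T|.
Proof.
by rewrite mulnC -sum_nat_const; apply: leq_sum => x _; apply: eccentricity_le.
Qed.

Lemma ecc_min_eq : ecc e = 2 * #|T| -> forall x, eccentricity e x = 2.
Proof.
rewrite mulnC -sum_nat_const => ecc2 x.
have [_ /esym] := leqif_sum (fun x (_ : xpredT x) => leqif_eq (eccentricity_ge2 x)).
by rewrite -ecc2 eqxx => /forallP/(_ x)/eqP.
Qed.

Lemma ecc_max_eq : ecc e = m * #|T| -> forall x, eccentricity e x = m.
Proof.
rewrite mulnC -sum_nat_const => eccm x.
have [_ /esym] := leqif_sum (fun x (_ : xpredT x) => leqif_eq (eccentricity_le x)).
by rewrite -eccm eqxx => /forallP/(_ x)/eqP.
Qed.

(** * Graphs with all eccentricities equal to 2 *)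

Lemma neighbour x : exists y, e x y.
Proof.
have [y dxy] := eccentricity_witness x.
have [|z /eqP dz] := @dist_level x y 1; first by rewrite dxy eccentricity_gt0.
by exists z; rewrite -dist_eq1 // -dist_eq0 (eqP dz).
Qed.

Lemma ecc2_adj : (forall x, eccentricity e x = 2) ->
  forall x y, e x y = (colour x != colour y).
Proof.
move=> ecc2 x y; apply/idP/idP => [/colour_adj-> | neq_c].
  by case: (colour x).
have xy : x != y by apply: contraNneq neq_c => ->.
rewrite -dist_eq1 //; have := le_eccentricity y x; rewrite ecc2.
have : odd (dist e x y) by rewrite dist_parity addbC -negb_eqb eq_sym.
by clear; lia.
Qed.

(** For an edge [xy] with [y] of colour [c], a vertex closer to [x] than to [y] is either of colour
    [c] and distinct from [y], or adjacent to [y] and then equal to [x]. Trading [x] for [y], there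
    are at most as many as vertices of colour [c]. *)
Lemma ecc2_card_colour c : (forall x, eccentricity e x = 2) ->
  m <= #|[set x | colour x == c]|.
Proof.
move=> ecc2; have [x [y [exy cy]]] : exists x y, e x y /\ colour y = c.
  have /card_gt0P[x _] : 0 < #|T| by lia.
  have [y exy] := neighbour x; have := colour_adj exy.
  case cx: (colour x == c); last by exists x, y; split=> //; lia.
  by exists y, x; rewrite e_sym exy (eqP cx).
have [_ _ /leq_trans] := card_closer exy; apply; rewrite -cy.
set B := [set _ | _]; have yB : y \in B by rewrite inE.
apply: (@leq_trans #|x |: (B :\ y)|); last first.
  by rewrite (cardsD1 y B) yB cardsU1 leq_add2r leq_b1.
apply/subset_leq_card/subsetP => u; rewrite !inE => lt_d.
have [cu | cu] := eqVneq (colour u) (colour y).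
  by rewrite andbT orbC; case: eqP lt_d => // ->; rewrite dist_self ltn0.
have : e u y by rewrite ecc2_adj.
by move/dist_edge => d1; rewrite -dist_eq0 andbF orbF -leqn0 -ltnS (leq_trans lt_d).
Qed.

(** * Graphs with all eccentricities equal to [m] *)

Section Extremal.

Hypothesis ecc_m : forall x, eccentricity e x = m.

Lemma dist_le_m x y : dist e x y <= m.
Proof. by rewrite -(ecc_m y) le_eccentricity. Qed.

Lemma level_neq0 x i : i <= m -> exists y, y \in level x i.
Proof.
have [y dxy] := eccentricity_witness x; rewrite ecc_m in dxy.
by rewrite -dxy => /dist_level[z dxz]; exists z; rewrite inE dxz.
Qed.

Lemma inner_level_ge2 x i : 0 < i -> i < m -> 1 < #|level x i|.
Proof.
have [y dxy] := eccentricity_witness x; rewrite ecc_m in dxy.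
by move=> i_gt0; rewrite -dxy; apply: card_level_ge2.
Qed.

Lemma level1E x y : (y \in level x 1) = e x y.
Proof.
rewrite inE; have [<-|xy] := eqVneq x y; last exact: dist_eq1.
by rewrite dist_self e_irr.
Qed.

(* The levels of sizes 1, 2, ..., 2, 1 would account for 2m vertices, and there
   are 2m + 1: a single level has one vertex more. *)
Lemma level_excess x i j : i <= m -> j <= m -> i != j ->
  #|level x i| + #|level x j| <= min_level m i + min_level m j + 1.
Proof.
move=> le_im le_jm neq_ij.
have min_le (k : 'I_m.+1) : min_level m k <= #|level x k|.
  by rewrite -{1}(ecc_m x) min_level_le // ecc_m -ltnS.
have := @sumnB _ (index_enum _) xpredT _ _ (fun k _ => min_le k).
rewrite sum_levels ?ecc_m // sum_min_level ?(ltnW m_gt1) // subSnn.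
rewrite (bigD1 (Ordinal (le_im : i < m.+1))) //=.
rewrite (bigD1 (Ordinal (le_jm : j < m.+1))) /=; last first.
  by rewrite -val_eqE /= eq_sym.
lia.
Qed.

Lemma min_level_le2 k i : min_level k i <= 2.
Proof. by rewrite /min_level; case: ifP. Qed.

(** Rewrites the degree sum of a colour class as a count of edges between the classes, so that
    exchanging the sums compares the two classes. *)
Lemma degree_sum c :
  \sum_(x | colour x == c) #|level x 1|
    = \sum_(x | colour x == c) \sum_(y | colour y == ~~ c) e x y.
Proof.
apply: eq_bigr => x /eqP cx; rewrite -sum1_card big_mkcond [RHS]big_mkcond.
apply: eq_bigr => y _; rewrite level1E.
by case exy: (e x y); [rewrite (colour_adj exy) cx eqxx | case: ifP].
Qed.

Lemma degree3_exists : exists v, #|level v 1| = 3.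
Proof.
case: (pickP (fun v => #|level v 1| == 3)) => [v /eqP|deg3]; first by exists v.
have deg2 x : #|level x 1| = 2.
  (* Comparing level 1 with the nonempty level 0 leaves only the degrees 2 and 3. *)
  have := level_excess x (ltnW m_gt1) (leq0n m) isT.
  have /card_gt0P lt0 : exists y, y \in level x 0 by apply: level_neq0.
  have := inner_level_ge2 x (isT : 0 < 1) m_gt1; have := deg3 x.
  by have := min_level_le2 m 1; rewrite {3}/min_level /=; lia.
have degs c : \sum_(x | colour x == c) #|level x 1| = #|[set x | colour x == c]| * 2.
  by rewrite (eq_bigr (fun=> 2)) // sum_nat_const cardsE.
have /eqP : \sum_(x | colour x == true) #|level x 1|
    = \sum_(x | colour x == false) #|level x 1|.
  rewrite !degree_sum exchange_big.
  by apply: eq_bigr => x _; apply: eq_bigr => y _; rewrite e_sym.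
rewrite !degs eqn_mul2r /= => /eqP eq_card.
have := cardsC [set x | colour x == true]; rewrite orderE.
have -> : ~: [set x | colour x == true] = [set x | colour x == false].
  by apply/setP=> x; rewrite !inE; case: (colour x).
lia.
Qed.

Section DegreeThree.

Variable v : T.
Hypothesis deg_v : #|level v 1| = 3.

(** Level 1 of [v] holds the extra vertex, so level 2 is minimal: two vertices, or one if it is the
    last level. *)
Lemma card_level2 : #|level v 2| <= (2 < m).+1.
Proof.
have := level_excess v (ltnW m_gt1) m_gt1 isT; rewrite deg_v.
by rewrite /min_level /= (ltn_eqF m_gt1); have := m_gt1; case: (ltngtP 2 m); lia.
Qed.

(** Since the other vertex [q] of level 2 is not a cut vertex, some vertex of level 2 distinct from
    [q] has a neighbour in level 3; it can only be [p]. *)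
Lemma level2_down p : 2 < m -> p \in level v 2 ->
  exists2 t, t \in level v 3 & e p t.
Proof.
move=> m_gt2 p2; have [y dvy] := eccentricity_witness v; rewrite ecc_m in dvy.
have /card_gt1P[q0 [q1 [q0_2 q1_2 q01]]] := @inner_level_ge2 v 2 isT m_gt2.
have [q q2 qp] : exists2 q, q \in level v 2 & q != p.
  by have [q0p|] := eqVneq q0 p; [exists q1; rewrite // -q0p eq_sym | exists q0].
have [|z [t [zq z2 t3 ezt]]] := @level_down v 2 q y isT _ q2; first by rewrite dvy.
suff <- : z = p by exists t.
apply/eqP; apply: contraTT card_level2 => zp; rewrite m_gt2 -ltnNge.
by apply/card_gt2P; exists z, q, p; do 2?split=> //; rewrite eq_sym.
Qed.

(** If [p] and [t] differ, level 1 of [a] contains [v], [p], [t], and level 2 of [a] contains the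
    two other neighbours of [v] and a vertex of level 3 of [v] beyond [p]. Two levels of [a] would
    then exceed their minimal sizes. *)
Lemma level2_up_unique a p t : a \in level v 1 -> p \in level v 2 ->
  t \in level v 2 -> e a p -> e a t -> p = t.
Proof.
move=> a1 p2 t2 eap eat; apply/eqP; apply: contraT => pt.
have m_gt2 : 2 < m.
  have : 1 < #|level v 2| by apply/card_gt1P; exists p, t.
  by have := card_level2; lia.
have [p' p'3 epp'] := level2_down m_gt2 p2.
have eva : e v a by rewrite -level1E.
have deg_a : 2 < #|level a 1|.
  apply/card_gt2P; exists v, p, t; rewrite !level1E e_sym eva eap eat; do 2?split=> //.
  - by apply: contraTneq p2 => <-; rewrite inE dist_self.
  - by apply: contraTneq t2 => ->; rewrite inE dist_self.
have two x : x != a -> ~~ e a x -> (exists2 u, e a u & e u x) -> x \in level a 2.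
  move=> xa nax [u eau eux]; rewrite inE.
  have /eqP du : dist e a u == 1 by rewrite -level1E inE in eau.
  have := dist_adj a eux; rewrite du.
  have : dist e a x != 1 by rewrite -level1E inE in nax.
  have : dist e a x != 0 by rewrite dist_eq0 eq_sym.
  by clear; lia.
have sub : p' |: (level v 1 :\ a) \subset level a 2.
  apply/subsetP => x; rewrite in_setU1 in_setD1.
  have no_adj i j : (i == j) || (i == j.+2) || (j == i.+2) -> forall x y,
      x \in level v i -> y \in level v j -> ~~ e x y.
    move=> ij y z; rewrite !inE => /eqP dy /eqP dz; apply/negP => eyz.
    have := dist_adj v eyz; have := dist_adj_neq v eyz.
    by rewrite e_sym in eyz; have := dist_adj v eyz; rewrite dy dz; move: ij; clear; lia.
  case/orP=> [/eqP-> | /andP[xa x1]]; apply: two => //.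
  - by apply: contraTneq a1 => <-; move: p'3; rewrite !inE => /eqP->.
  - exact: (no_adj 1 3 isT).
  - by exists p.
  - exact: (no_adj 1 1 isT).
  - by exists v; [rewrite e_sym | rewrite -level1E].
have := subset_leq_card sub; rewrite cardsU1 in_setD1.
have -> : (p' \in level v 1) = false by move: p'3; rewrite !inE => /eqP->.
rewrite andbF /=; have := cardsD1 a (level v 1); rewrite a1 deg_v.
have := level_excess a (ltnW m_gt1) m_gt1 isT.
by have := min_level_le2 m 1; have := min_level_le2 m 2; move: deg_a; clear; lia.
Qed.

Lemma level1_down a : a \in level v 1 -> exists2 p, p \in level v 2 & e a p.
Proof.
move=> a1; have eav : e a v by rewrite e_sym -level1E.
have /card_gt1P[q0 [q1 [q0_1 q1_1 q01]]] := inner_level_ge2 a (isT : 0 < 1) m_gt1.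
rewrite !level1E in q0_1 q1_1.
have [q eaq qv] : exists2 q, e a q & q != v.
  by have [q0v|] := eqVneq q0 v; [exists q1; rewrite // -q0v eq_sym | exists q0].
exists q => //; have := level_adj eaq a1.
by rewrite [q \in level v 0]inE dist_eq0 eq_sym (negPf qv).
Qed.

(** Three vertices of level 1 choose neighbours among at most two vertices of level 2, so two of
    them choose the same [p]; the uniqueness of this choice determines their neighbourhoods. *)
Lemma twins : exists a b p,
  [/\ a != b, v != p,
      (forall y, e a y = (y == v) || (y == p)),
      (forall y, e b y = (y == v) || (y == p)) &
      (forall u, u \in [:: v; p] -> exists c, [/\ e u c, c != a & c != b])].
Proof.
have [f f2 ef] : exists2 f, {in level v 1, forall u, f u \in level v 2}
                           & {in level v 1, forall u, e u (f u)}.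
  have fP u : {p | u \in level v 1 -> (p \in level v 2) && e u p}.
    case: (pickP [pred p in level v 2 | e u p]) => [p|no_p]; first by exists p.
    (* A placeholder: for [u] in level 1 this case cannot arise. *)
    exists u => /level1_down[p p2 eup].
    by have := no_p p; rewrite /= p2 eup.
  exists (fun u => sval (fP u)) => u u1; by case: (fP u) => p /= /(_ u1)/andP[].
have /dinjectivePn[a a1 [b /andP[ba b1] fab]] : ~~ dinjectiveb f (level v 1).
  apply/dinjectiveP => /card_in_imset cardf.
  have : f @: level v 1 \subset level v 2.
    by apply/subsetP => _ /imsetP[u u1 ->]; apply: f2.
  move/subset_leq_card; rewrite cardf deg_v; have := card_level2; lia.
have p2 := f2 a a1; have eap := ef a a1; have ebp := ef b b1; rewrite -fab in ebp.
have [c c1 /andP[ca cb]] : exists2 c, c \in level v 1 & (c != a) && (c != b).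
  have : 0 < #|level v 1 :\ a :\ b|.
    have := cardsD1 a (level v 1); have := cardsD1 b (level v 1 :\ a).
    by rewrite deg_v in_setD1 a1; lia.
  case/card_gt0P => c; rewrite !in_setD1 => /and3P[cb ca c1].
  by exists c; rewrite // ca cb.
have adj u : u \in level v 1 -> e u (f a) -> forall y, e u y = (y == v) || (y == f a).
  move=> u1 eup y; apply/idP/orP => [euy | [/eqP->|/eqP->//]]; last first.
    by rewrite e_sym -level1E.
  have [|y2] := orP (level_adj euy u1).
    by rewrite andbT inE dist_eq0 eq_sym; left.
  by right; rewrite (level2_up_unique u1 p2 y2 eup euy).
exists a, b, (f a); split; [by rewrite eq_sym| | exact: adj | exact: adj | ].
  by apply: contraTneq p2 => <-; rewrite inE dist_self.
move=> u; rewrite !inE => /orP[]/eqP->; first by exists c; rewrite -level1E.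
(* The third neighbour of [p] comes from level 3 if there is one. Otherwise level 2 is just [p], and
   the third neighbour [c] of [v] is adjacent to it. *)
have [m_gt2 | m_le2] := ltnP 2 m.
  have [t t3 ept] := level2_down m_gt2 p2; exists t; rewrite ept.
  by split=> //; [apply: contraTneq a1 | apply: contraTneq b1] => <-;
     move: t3; rewrite !inE => /eqP->.
exists c; split=> //; suff -> : f a = f c by rewrite e_sym ef.
have := card_level2; rewrite ltnNge m_le2 /= => /card_le1P/(_ _ p2 (f c)).
by rewrite f2 // inE => /esym/eqP.
Qed.

End DegreeThree.

(** The last step of a shortest path to one twin can be redirected to the other. *)
Lemma twin_dist a b v p x :
    (forall y, e a y = (y == v) || (y == p)) ->
    (forall y, e b y = (y == v) || (y == p)) ->
  x != a -> x != b -> dist e x a = dist e x b.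
Proof.
move=> adj_a adj_b xa xb.
suff le a' b' : (forall y, e a' y = e b' y) -> x != a' -> dist e x b' <= dist e x a'.
  by apply/eqP; rewrite eqn_leq !le // => y; rewrite adj_a adj_b.
move=> adj xa'; case dxa: (dist e x a') => [|k].
  by move/eqP: dxa; rewrite dist_eq0 (negPf xa').
have [z <- eza] := dist_pred dxa; apply: dist_adj.
by rewrite e_sym -adj e_sym.
Qed.

(** By [twin_dist], [a] and [b] share a level [i > 1] of [x]. If [x] had degree 3, that level would
    be minimal, so [i < m] and it consists of [a] and [b] alone. *)
Lemma degree_le2 a b v p x : a != b ->
    (forall y, e a y = (y == v) || (y == p)) ->
    (forall y, e b y = (y == v) || (y == p)) ->
    (forall u, u \in [:: v; p] -> exists c, [/\ e u c, c != a & c != b]) ->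
  x \notin [:: v; p; a; b] -> #|level x 1| <= 2.
Proof.
move=> ab adj_a adj_b third; rewrite !inE !negb_or => /and4P[xv xp xa xb].
rewrite leqNgt; apply/negP => deg_x.
have dab := twin_dist adj_a adj_b xa xb.
pose i := dist e x a; have a_i : a \in level x i by rewrite inE.
have b_i : b \in level x i by rewrite inE -dab.
have i_gt1 : 1 < i.
  have : i != 0 by rewrite dist_eq0.
  have : i != 1 by rewrite dist_eq1 // e_sym adj_a negb_or xv.
  by clear; lia.
have card_i : 1 < #|level x i| by apply/card_gt1P; exists a, b.
have i_le_m : i <= m := dist_le_m x a.
have := level_excess x (ltnW m_gt1) i_le_m (negbT (ltn_eqF i_gt1)).
rewrite {1}/min_level /= (ltn_eqF m_gt1) {1}/min_level (gtn_eqF (ltnW i_gt1)) /=.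
case: (i =P m) => [_ | i_neq_m]; first by move: deg_x card_i; clear; lia.
move=> card_sum; have {i_neq_m} i_lt_m : i < m by move: i_le_m i_neq_m; clear; lia.
have level_i : level x i = [set a; b].
  apply/esym/eqP; rewrite eqEcard cards2 ab subUset !sub1set a_i b_i /=.
  by move: deg_x card_i card_sum; clear; lia.
have vp_pred u : (u \in [:: v; p]) -> e a u by rewrite adj_a !inE.
have up u : u \in level x i.+1 -> u \in [:: v; p].
  case/level_pred => z; rewrite level_i !inE => /orP[]/eqP->.
    by rewrite adj_a.
  by rewrite adj_b.
have [t t_up] := level_neq0 x i_lt_m.
(* One of [v], [p] precedes level [i], so level [i.+1] contains only the other one, [t]. The third
   neighbour of [t] then lies in level [i.+2], which makes the singleton level [i.+1] an inner
   level. *)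
have [s s_down eas] : exists2 s, s \in level x i.-1 & e s a.
  by apply: level_pred; rewrite prednK // ltnW.
have disj u : u \in level x i.-1 -> u \notin level x i.+1.
  by rewrite !inE => /eqP->; move: i_gt1; clear; lia.
have level_up : level x i.+1 = [set t].
  apply/eqP; rewrite eqEsubset sub1set t_up andbT; apply/subsetP => u u_up.
  have s_vp : s \in [:: v; p] by rewrite !inE -adj_a e_sym.
  have su : s != u by apply: contraNneq (disj s s_down) => ->.
  have st : s != t by apply: contraNneq (disj s s_down) => ->.
  move: s_vp (up u u_up) (up t t_up) su st; rewrite !inE.
  by do 3!case/orP=> /eqP->; rewrite ?eqxx.
have [c [etc ca cb]] := third t (up t t_up).
have := level_adj etc t_up; rewrite /= level_i !inE (negPf ca) (negPf cb) /=.
move=> /eqP dxc; have := dist_le_m x c; rewrite dxc => i_lt2_m.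
by have := inner_level_ge2 x (ltn0Sn i) i_lt2_m; rewrite level_up cards1.
Qed.

Lemma extremal_iso : isomorphic e (hatted_cycle #|T|).
Proof.
have [v deg_v] := degree3_exists.
have [a [b [p [ab vp adj_a adj_b third]]]] := twins deg_v.
have eav : e a v by rewrite adj_a eqxx.
have eap : e a p by rewrite adj_a eqxx orbT.
have ebv : e b v by rewrite adj_b eqxx.
have ebp : e b p by rewrite adj_b eqxx orbT.
apply: (hatted_cycle_iso e_sym e_irr vp ab adj_a adj_b); last first.
  by move=> A B; apply: no_cut_vertex.
move=> x xb; have deg_ge2 : 2 <= #|level x 1| := @inner_level_ge2 x 1 isT m_gt1.
have setE : [set y | e x y & y != b] = level x 1 :\ b.
  by apply/setP=> y; rewrite in_setD1 level1E inE andbC.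
rewrite {}setE.
(* The vertices [v] and [p] have degree exactly 3: [a], [b] and a third neighbour give at least 3,
   the excess bound at most 3. Deleting [b] leaves 2. *)
have [x_vp | x_nvp] := boolP (x \in [:: v; p]).
  have b1 : b \in level x 1.
    by move: x_vp; rewrite level1E e_sym !inE => /orP[]/eqP->.
  have a1 : a \in level x 1.
    by move: x_vp; rewrite level1E e_sym !inE => /orP[]/eqP->.
  have [c [exc ca cb]] := third x x_vp.
  have deg_gt2 : 2 < #|level x 1|.
    apply/card_gt2P; exists a, b, c; rewrite -level1E in exc.
    by split; split; rewrite // eq_sym.
  have := level_excess x (leq0n m) (ltnW m_gt1) isT.
  have /card_gt0P : exists y, y \in level x 0 by apply: level_neq0.
  have := cardsD1 b (level x 1); rewrite b1.
  rewrite {1}/min_level /= /min_level (ltn_eqF m_gt1) /=.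
  by move: deg_gt2; clear; lia.
have nb1 : b \notin level x 1 by rewrite level1E e_sym adj_b; move: x_nvp; rewrite !inE.
have -> : level x 1 :\ b = level x 1.
  by apply/setDidPl; rewrite disjoint_sym disjoints1.
apply/eqP; rewrite eqn_leq deg_ge2 andbT.
have [-> | xa] := eqVneq x a.
  have -> : level a 1 = [set v; p].
    by apply/setP=> y; rewrite level1E adj_a !inE.
  by rewrite cards2 vp.
apply: (degree_le2 ab adj_a adj_b third).
by move: x_nvp; rewrite !inE !negb_or xa xb => /andP[-> ->].
Qed.

End Extremal.

End Distance.

(** * Eccentricities in the two model graphs *)

Definition cyclic_dist N i j := minn (i - j + (j - i)) (N - (i - j + (j - i))).

(* The hat is placed above the cycle vertex 1, which has the same neighbours, so
   that the cyclic distance of positions is 1-Lipschitz. *)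
Lemma hatted_cycle_far (T : finType) (e : rel T) n (x : T) :
    connected_graph e -> 5 <= n -> isomorphic e (hatted_cycle n) ->
  exists y, (n - 1)./2 <= dist e x y.
Proof.
move=> e_conn n_ge5 [h [g hK gK] edge_h].
pose pos y : nat := if h y == n - 1 :> nat then 1 else h y.
have pos_lt y : pos y < n - 1.
  by rewrite /pos; case: eqP => [_|]; have := ltn_ord (h y); lia.
pose dx y := cyclic_dist (n - 1) (pos x) (pos y).
have pos_arc y z : hatted_arc (h y) (h z) ->
    pos z = (pos y).+1 %% (n - 1) \/ pos y = (pos z).+1 %% (n - 1).
  rewrite /hatted_arc /pos.
  case/orP => [/and3P[yn zn /eqP yz] | /andP[-> /orP[/eqP->|/eqP->]]].
  - by left; rewrite (ltn_eqF yn) (ltn_eqF zn).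
  - by right; rewrite ifF ?modn_small //; lia.
  - by left; rewrite ifF ?modn_small //; lia.
have dx_step i j k : i < n - 1 -> j < n - 1 -> k = j.+1 %% (n - 1) ->
    cyclic_dist (n - 1) i k <= (cyclic_dist (n - 1) i j).+1
    /\ cyclic_dist (n - 1) i j <= (cyclic_dist (n - 1) i k).+1.
  move=> iN jN; have [jE | jE] := eqVneq j.+1 (n - 1).
    by rewrite jE modnn => ->; rewrite /cyclic_dist; lia.
  by rewrite modn_small => [->|]; rewrite /cyclic_dist; lia.
have dx_lip y z : e y z -> dx z <= (dx y).+1.
  rewrite -edge_h /hatted_cycle => /orP[] /pos_arc[] /dx_step st;
  by have [] := st (pos x) (pos_lt _) (pos_lt _).
(* A position opposite to that of [x]: half a turn forwards or backwards, whichever stays within the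
   range. *)
pose k := if pos x < (n - 1)./2 then pos x + (n - 1)./2 else pos x - (n - 1)./2.
have kN : k < n - 1 by rewrite /k; case: ifP; have := pos_lt x; lia.
have kn : k < n by lia.
exists (g (Ordinal kn)).
have := lipschitz_le_dist e_conn x (g (Ordinal kn)) dx_lip.
have -> : dx x = 0 by rewrite /dx /cyclic_dist; lia.
rewrite add0n; apply: leq_trans.
rewrite /dx {2}/pos gK /= (ltn_eqF kN) /cyclic_dist /k.
by case: ifP; have := pos_lt x; lia.
Qed.

Lemma complete_bipartite_ecc (T : finType) (e : rel T) p q :
    symmetric e -> connected_graph e -> 0 < p -> 0 < q ->
    isomorphic e (complete_bipartite p q) ->
  forall x, eccentricity e x <= 2.
Proof.
move=> e_sym e_conn p_gt0 q_gt0 [h [g hK gK] edge_h] x.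
apply/bigmax_leqP => y _.
(* A vertex of the part opposite to [x]. A vertex not adjacent to [x] lies in the part of [x], hence
   is adjacent to [w]. *)
pose w : 'I_p + 'I_q := if h x is inl _ then inr (Ordinal q_gt0) else inl (Ordinal p_gt0).
have exw : e x (g w) by rewrite -edge_h gK /w; case: (h x).
rewrite (distC e_sym e_conn); have [exy | nxy] := boolP (e x y).
  exact: leq_trans (dist_edge exy) _.
have ewy : e (g w) y.
  by move: nxy; rewrite -!edge_h gK /w; case: (h x) => ?; case: (h y).
by apply: leq_trans (dist_adj e_conn x ewy) _; rewrite ltnS dist_edge.
Qed.

(** * Assembly of the bounds and of the two equality cases *)

Theorem theorem3p2 (T : finType) (e : rel T) (n : nat)
  (e_simple : simple_graph e) (e_STI : STI e)
  (card_T : #|T| = n) (n_ge4 : 4 <= n) :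
  (2 * n <= ecc e <= (n * (n - 1)) %/ 2) /\
  (ecc e = 2 * n <->
     isomorphic e (complete_bipartite ((n - 1) %/ 2) ((n + 1) %/ 2))) /\
  (ecc e = (n * (n - 1)) %/ 2 <-> isomorphic e (hatted_cycle n)).
Proof.
have [e_sym _] := e_simple; have [e_conn _] := e_STI.
subst n; have orderE := orderE e_sym e_conn e_STI n_ge4.
have halfE : #|T| * (#|T| - 1) %/ 2 = #|T|./2 * #|T|.
  by rewrite {2}orderE subn1 /= -muln2 mulnA mulnK // mulnC.
have ecc_ge := ecc_ge e_sym e_conn e_STI n_ge4.
have ecc_le := ecc_le e_sym e_conn e_STI n_ge4.
rewrite halfE ecc_ge ecc_le; split=> //; split; split.
- move=> /(ecc_min_eq e_sym e_conn e_STI n_ge4) ecc2.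
  have pE : (#|T| - 1) %/ 2 = #|T|./2 by rewrite {1}orderE subn1 /= divn2 doubleK.
  have qE : (#|T| + 1) %/ 2 = #|T|./2.+1.
    by rewrite {1}orderE addn1 -doubleS divn2 doubleK.
  pose A c := [set x | odd (transmission e x) == c].
  have card_A c : #|T|./2 <= #|A c| by apply: ecc2_card_colour.
  have AC c : ~: A c = A (~~ c).
    by apply/setP=> x; rewrite !inE; case: (odd _); case: c.
  (* Both colour classes have at least [m] vertices and together [2m + 1], so one has exactly [m];
     it becomes the smaller part. *)
  have [c cardc] : exists c, #|A c| = #|T|./2.
    have sum_A := cardsC (A true); rewrite AC /= orderE in sum_A.
    have := card_A true; have := card_A false => le_f le_t.
    have [eq_t | neq_t] := eqVneq #|A true| #|T|./2; first by exists true.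
    by exists false; move: orderE le_f le_t sum_A neq_t; clear; lia.
  rewrite pE qE; apply: (@complete_bipartite_iso _ _ (A c)) => // [|x y].
    by have := cardsC (A c); rewrite cardc {2}orderE; clear; lia.
  rewrite (ecc2_adj e_conn e_STI ecc2) !inE.
  by case: (odd (transmission e x)); case: (odd (transmission e y)); case: (c).
- move=> iso_e; apply/eqP; rewrite eqn_leq ecc_ge andbT.
  rewrite mulnC -sum_nat_const; apply: leq_sum => x _.
  by apply: (complete_bipartite_ecc e_sym e_conn _ _ iso_e); move: n_ge4; clear; lia.
- move=> /(ecc_max_eq e_sym e_conn e_STI n_ge4) ecc_m.
  exact: extremal_iso.
- move=> iso_e; apply/eqP; rewrite eqn_leq ecc_le.
  rewrite mulnC -sum_nat_const; apply: leq_sum => x _.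
  have n_ge5 : 5 <= #|T| by move: orderE n_ge4; clear; lia.
  have [y le_d] := hatted_cycle_far x e_conn n_ge5 iso_e.
  apply: leq_trans (le_eccentricity e x y); rewrite (distC e_sym e_conn).
  by apply: leq_trans le_d; move: orderE; clear; lia.
Qed.
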